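(* Let $n\ge 1$ and $d_1,d_2\ge 2$ be integers with $d_1\le d_2^2$. There is no absolutely maximally entangled (AME) state in $\mathbb{C}^{d_1}\otimes(\mathbb{C}^{d_2})^{\otimes 2n}$ if one of the following holds: (i) $d_1<d_2$ and $n>\dfrac{d_2^4-d_1}{d_2^2-d_1}-2$; or (ii) $d_2\le d_1\le d_2^2$ and $n>\dfrac{d_2^2(d_1+1)}{d_1}-1$.
   Context: A pure state in a tensor product $\mathbb{C}^{\delta_1}\otimes\cdots\otimes\mathbb{C}^{\delta_N}$ is a unit vector $|\psi\rangle$, with density matrix $\rho=|\psi\rangle\langle\psi|$. For $B\subseteq[N]=\{1,\dots,N\}$, the reduced density matrix $\rho_B$ is the partial trace of $\rho$ over the tensor factors indexed by $[N]\setminus B$. The state $|\psi\rangle$ is called an absolutely maximally entangled (AME) state if for every subset $B\subseteq[N]$ with $|B|=\lfloor N/2\rfloor$, $\rho_B=\frac{1}{\prod_{i\in B}\delta_i}I$ (maximally mixed). Here $N=2n+1$, with one factor of dimension $d_1$ and $2n$ factors of dimension $d_2$. *)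

(* Defs.v *)
From mathcomp Require Import all_boot all_order all_algebra.
From mathcomp Require Import reals.
From mathcomp Require Export complex.

Set Implicit Arguments.
Unset Strict Implicit.
Unset Printing Implicit Defensive.

Import Order.TTheory GRing.Theory Num.Theory.
Local Open Scope ring_scope.

(* The tensor product of the C^(delta i), i in B, is represented by its
   coordinates on the computational basis, which is indexed by the families
   (x_i)_(i in B) with x_i < delta i. Vectors and operators are matrices of
   size the number of these families, indexed through enum_rank/enum_val. *)

Definition config (N : nat) (delta : 'I_N -> nat) : finType :=
  {dffun forall i : 'I_N, 'I_(delta i)}.

Definition sub_config (N : nat) (delta : 'I_N -> nat) (B : {set 'I_N})
    : finType :=
  {dffun forall i : {j : 'I_N | j \in B}, 'I_(delta (val i))}.

Definition restr (N : nat) (delta : 'I_N -> nat) (B : {set 'I_N})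
    (x : config delta) : sub_config delta B :=
  [ffun i : {j : 'I_N | j \in B} => x (val i)].

Definition pure_state (R : realType) (N : nat) (delta : 'I_N -> nat)
    (psi : 'cV[R[i]]_#|config delta|) : Prop :=
  \sum_k `|psi k 0| ^+ 2 = 1.

Definition density (R : realType) (N : nat) (delta : 'I_N -> nat)
    (psi : 'cV[R[i]]_#|config delta|) : 'M[R[i]]_#|config delta| :=
  psi *m (map_mx Num.conj psi)^T.

(* Partial trace over the factors outside B: the pairs (x, y) in the sum are
   the (a, z), (b, z) with z running over the basis of the factors outside B. *)
Definition partial_trace (R : realType) (N : nat) (delta : 'I_N -> nat)
    (B : {set 'I_N}) (rho : 'M[R[i]]_#|config delta|)
    : 'M[R[i]]_#|sub_config delta B| :=
  \matrix_(a, b)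
    \sum_(x : config delta | restr B x == enum_val a)
      \sum_(y : config delta |
             (restr B y == enum_val b) && (restr (~: B) x == restr (~: B) y))
        rho (enum_rank x) (enum_rank y).

Definition AME (R : realType) (N : nat) (delta : 'I_N -> nat)
    (psi : 'cV[R[i]]_#|config delta|) : Prop :=
  pure_state psi /\
  forall B : {set 'I_N}, #|B| = N./2 ->
    partial_trace B (density psi) = (\prod_(i in B) (delta i)%:R)^-1 *: 1%:M.

Definition one_plus_even_dims (n d1 d2 : nat) : 'I_(2 * n + 1) -> nat :=
  fun i => if i == 0%N :> nat then d1 else d2.

Arguments one_plus_even_dims : clear implicits.

(* Main.v *)
(** For a set V of factors let P_V be the orthogonal projection, in the
    Hilbert-Schmidt space of operators, that traces out the factors in V and
    puts maximally mixed states in their place. Then P_V P_V' = P_(V :|: V'),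
    so <P_V rho, P_V' rho> = <rho, P_(V :|: V') rho>; for pure rho this number
    is (prod_(i in V) delta_i)^-1 times the purity of the reduction to the
    complement of V. An AME state has all of its purities prescribed. Given T
    with n + 2 elements, W its complement and I the set of all factors, the
    components P_(i |: W) rho - P_I rho, for i in T, are therefore pairwise
    orthogonal, and Bessel's inequality for P_W rho - P_I rho is an inequality
    between the dimensions. Case (i) is the inequality for a T without the
    factor of dimension d1, case (ii) for a T containing it. *)

Require Import Defs.
From mathcomp Require Import all_boot all_order all_algebra.
From mathcomp Require Import reals.
From mathcomp Require Import ring lra zify.

Set Implicit Arguments.
Unset Strict Implicit.
Unset Printing Implicit Defensive.

Import Order.TTheory GRing.Theory Num.Theory.
Local Open Scope ring_scope.

(** * Sums and products over finite families *)

Lemma sum_dffun_prod (C : comPzSemiRingType) (I : finType) (T_ : I -> finType)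
    (F : forall i, T_ i -> C) :
  \sum_(x : {dffun forall i, T_ i}) \prod_i F i (x i) =
  \prod_i \sum_a F i a.
Proof.
pose G i := finfun (F i).
transitivity (\sum_(t : fprod T_) \prod_i G i (t i)).
  rewrite [RHS](reindex (@fprod_of_dffun I T_)).
    apply: eq_bigr => x _; apply: eq_bigr => i _.
    by rewrite ffunE -{1}(fprod_of_dffunK x) ffunE.
  exact/onW_bij/fprod_of_dffun_bij.
(* Members of [fprod] send i to an element tagged i, which makes the non-dependent distributive law
   applicable; the default 0 of [untag] is never reached. *)
transitivity (\prod_i \sum_(j in tagged_with T_ i) untag 0 (G i) j).
  rewrite (bigA_distr_big_dep (fun i => tagged_with T_ i)
                              (fun i => untag 0 (G i))).
  exact: big_fprod.
apply: eq_bigr => i _; transitivity (\sum_a G i a).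
  exact/esym/(big_tag (fun i => G i)).
by apply: eq_bigr => a _; rewrite ffunE.
Qed.

Lemma sum_pair (C : nmodType) (I J : finType) (F : I * J -> C) :
  \sum_p F p = \sum_x \sum_y F (x, y).
Proof. by rewrite pair_bigA; apply: eq_bigr => -[]. Qed.

Lemma prod_setC (C : comPzSemiRingType) (I : finType) (V : {set I})
    (F : I -> C) :
  (\prod_(i in V) F i) * (\prod_(i in ~: V) F i) = \prod_i F i.
Proof.
rewrite [RHS](bigID (mem V)) /=; congr (_ * _).
by apply: eq_bigl => i; rewrite inE.
Qed.

Lemma ex_subset_card (I : finType) (A : {set I}) k :
  (k <= #|A|)%N -> exists2 B : {set I}, B \subset A & #|B| = k.
Proof.
move=> lekA; exists [set x in take k (enum A)].
  by apply/subsetP => x; rewrite inE => /mem_take; rewrite mem_enum.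
rewrite cardsE; have /card_uniqP-> := take_uniq k (enum_uniq A).
by rewrite size_takel // -cardE.
Qed.

(** * Bessel's inequality for orthogonal components of a vector *)

Section Bessel.
Variables (C : numClosedFieldType) (P I : finType).

Definition inner (f g : P -> C) : C := \sum_p (f p)^* * g p.

Lemma conj_inner f g : (inner f g)^* = inner g f.
Proof.
rewrite /inner rmorph_sum; apply: eq_bigr => p _.
by rewrite rmorphM /= conjCK mulrC.
Qed.

(** By the first hypothesis each [f i] is an orthogonal component of [e], not a unit vector, so all
    coefficients are 1: the squared norm of [e - F], [F] being the sum of the [f i], is
    [inner e e - inner F F], and it is nonnegative. *)
Lemma bessel (A : {set I}) (e : P -> C) (f : I -> P -> C) :
    (forall i, i \in A -> inner e (f i) = inner (f i) (f i)) ->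
    (forall i j, i \in A -> j \in A -> i != j -> inner (f i) (f j) = 0) ->
  \sum_(i in A) inner (f i) (f i) <= inner e e.
Proof.
move=> He Hf.
pose F p := \sum_(i in A) f i p.
have ge0 : 0 <= inner (fun p => e p - F p) (fun p => e p - F p).
  by apply: sumr_ge0 => p _; rewrite mulrC mul_conjC_ge0.
have eF : inner e F = \sum_(i in A) inner (f i) (f i).
  rewrite -(eq_bigr _ He) /inner exchange_big /=.
  by apply: eq_bigr => p _; rewrite mulr_sumr.
have Fe : inner F e = \sum_(i in A) inner (f i) (f i).
  rewrite -conj_inner eF rmorph_sum; apply: eq_bigr => i _; exact: conj_inner.
have FF : inner F F = \sum_(i in A) inner (f i) (f i).
  transitivity (\sum_(i in A) \sum_(j in A) inner (f i) (f j)).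
    rewrite /inner; under [RHS]eq_bigr do rewrite exchange_big.
    rewrite exchange_big /=; apply: eq_bigr => p _.
    rewrite rmorph_sum mulr_suml; apply: eq_bigr => i _.
    by rewrite mulr_sumr.
  apply: eq_bigr => i iA; rewrite (bigD1 i) //= big1 ?addr0 // => j /andP[jA ji].
  by rewrite Hf // eq_sym.
have E : inner (fun p => e p - F p) (fun p => e p - F p)
    = inner e e - inner e F - inner F e + inner F F.
  rewrite /inner -!sumrB -big_split; apply: eq_bigr => p _ /=.
  rewrite rmorphB; ring.
by rewrite E FF Fe eF subrK subr_ge0 in ge0.
Qed.
End Bessel.

(** * Matrix elements of the projections [P_V] *)

Section Kernel.
Variables (C : numClosedFieldType) (N : nat) (delta : 'I_N -> nat).
Implicit Types V : {set 'I_N}.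
Local Notation conf := (config delta).
Local Notation pairs := (conf * conf)%type.

(* Matrix elements of one tensor factor of the projection [P_V] of the header: when
   [b = (i \in V)], the operator on this factor is replaced by its trace times the
   maximally mixed state; otherwise it is left alone. *)
Definition site_kernel (m : nat) (b : bool) (a a' c c' : 'I_m) : C :=
  if b then (a == a')%:R * (c == c')%:R / m%:R
  else (a == c)%:R * (a' == c')%:R.

Lemma sum_delta (T : finType) (F : T -> C) c : \sum_a (a == c)%:R * F a = F c.
Proof.
rewrite (bigD1 c) //= eqxx mul1r big1 ?addr0 // => a /negbTE->.
by rewrite mul0r.
Qed.

Lemma sum_delta_sym (T : finType) (F : T -> C) c : \sum_a (c == a)%:R * F a = F c.
Proof. by under eq_bigr do rewrite eq_sym; exact: sum_delta. Qed.

Lemma ord_natr_neq0 m (a : 'I_m) : m%:R != 0 :> C.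
Proof. by rewrite pnatr_eq0; case: m a => // -[]. Qed.

Lemma site_kernel_comp m b b' (a0 a0' c c' : 'I_m) :
  \sum_a \sum_a' site_kernel b a0 a0' a a' * site_kernel b' a a' c c' =
  site_kernel (b || b') a0 a0' c c'.
Proof.
have m0 := ord_natr_neq0 c.
rewrite /site_kernel; case: b; case: b' => /=.
(* When both operations trace out, the m diagonal middle terms cancel one of the two factors 1/m. *)
- transitivity (\sum_(a : 'I_m)
      ((a0 == a0')%:R * (c == c')%:R / m%:R / m%:R : C)).
    apply: eq_bigr => a _.
    rewrite -[RHS](sum_delta_sym (fun=> _) a); apply: eq_bigr => a' _.
    by case: (a == a'); rewrite /= ?mulr0 ?mul0r //; field.
  by rewrite sumr_const card_ord -[LHS]mulr_natr; field.
- transitivity (\sum_a (a == c)%:R *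
     \sum_a' (a' == c')%:R * ((a0 == a0')%:R * (a == a')%:R / m%:R : C)).
    apply: eq_bigr => a _; rewrite mulr_sumr; apply: eq_bigr => a' _; ring.
  by rewrite sum_delta sum_delta.
- transitivity (\sum_a (a0 == a)%:R *
     \sum_a' (a0' == a')%:R * ((a == a')%:R * (c == c')%:R / m%:R : C)).
    apply: eq_bigr => a _; rewrite mulr_sumr; apply: eq_bigr => a' _; ring.
  by rewrite sum_delta_sym sum_delta_sym.
- transitivity (\sum_a (a0 == a)%:R *
     \sum_a' (a0' == a')%:R * ((a == c)%:R * (a' == c')%:R : C)).
    apply: eq_bigr => a _; rewrite mulr_sumr; apply: eq_bigr => a' _; ring.
  by rewrite sum_delta_sym sum_delta_sym.
Qed.

Lemma site_kernel_tr m b (c c' : 'I_m) :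
  \sum_a site_kernel b a a c c' = (c == c')%:R.
Proof.
have m0 := ord_natr_neq0 c; rewrite /site_kernel; case: b => /=.
  under eq_bigr do rewrite eqxx mul1r.
  by rewrite sumr_const card_ord -[LHS]mulr_natr; field.
by rewrite sum_delta.
Qed.

(** The matrix of [P_V] in the basis of matrix units; a pair of configurations is a row index and a
    column index. *)
Definition kernel V (p q : pairs) : C :=
  \prod_i site_kernel (i \in V) (p.1 i) (p.2 i) (q.1 i) (q.2 i).

Lemma kernel_comp V V' p q :
  \sum_r kernel V p r * kernel V' r q = kernel (V :|: V') p q.
Proof.
rewrite sum_pair.
transitivity (\sum_(x : conf) \prod_i \sum_a'
  site_kernel (i \in V) (p.1 i) (p.2 i) (x i) a' *
  site_kernel (i \in V') (x i) a' (q.1 i) (q.2 i)).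
  apply: eq_bigr => x _; rewrite -sum_dffun_prod; apply: eq_bigr => y _.
  by rewrite -big_split.
rewrite (sum_dffun_prod (fun i a => \sum_a'
  site_kernel (i \in V) (p.1 i) (p.2 i) a a' *
  site_kernel (i \in V') a a' (q.1 i) (q.2 i))).
by apply: eq_bigr => i _; rewrite site_kernel_comp inE.
Qed.

Lemma kernelC V p q : kernel V p q = kernel V q p.
Proof.
apply: eq_bigr => i _; rewrite /site_kernel; case: ifP => _; first by ring.
by rewrite eq_sym [p.2 i == _]eq_sym.
Qed.

Lemma conj_kernel V p q : (kernel V p q)^* = kernel V p q.
Proof.
rewrite rmorph_prod; apply: eq_bigr => i _; rewrite /site_kernel; case: ifP => _.
  by rewrite !rmorphM fmorphV !rmorph_nat.
by rewrite rmorphM !rmorph_nat.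
Qed.

Lemma prod_natr_eq V (x y : conf) :
  \prod_(i in V) (x i == y i)%:R = (restr V x == restr V y)%:R :> C.
Proof.
case: eqP => [/ffunP xy|xy].
  apply: big1 => i iV; have := xy (exist _ i iV); rewrite !ffunE /= => ->.
  by rewrite eqxx.
have [/forall_inP xyV|/forall_inPn[i iV nxy]] :=
    boolP [forall i in V, x i == y i].
  case: xy; apply/ffunP => -[i iV]; rewrite !ffunE /=; exact/eqP/xyV.
by rewrite (bigD1 i) //= (negbTE nxy) mul0r.
Qed.

Lemma prod_all_natr_eq (x y : conf) : \prod_i (x i == y i)%:R = (x == y)%:R :> C.
Proof.
case: eqP => [->|xy]; first by apply: big1 => i _; rewrite eqxx.
have [/forallP xyV|/forallPn[i nxy]] := boolP [forall i, x i == y i].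
  by case: xy; apply/ffunP => i; exact/eqP.
by rewrite (bigD1 i) //= (negbTE nxy) mul0r.
Qed.

Lemma kernel_tr V q : \sum_x kernel V (x, x) q = (q.1 == q.2)%:R.
Proof.
rewrite (sum_dffun_prod (fun i a =>
  site_kernel (i \in V) a a (q.1 i) (q.2 i))) -prod_all_natr_eq.
by apply: eq_bigr => i _; rewrite site_kernel_tr.
Qed.

Definition vol V : C := \prod_(i in V) (delta i)%:R.

Lemma vol_neq0 V (x : conf) : vol V != 0.
Proof. by apply/prodf_neq0 => i _; exact: ord_natr_neq0 (x i). Qed.

Lemma vol_setC V : vol V * vol (~: V) = vol setT.
Proof. by rewrite /vol prod_setC; apply: eq_bigl => i; rewrite inE. Qed.

(** Grouping the factors inside and outside [V] brings the kernel to the terms in which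
    [partial_trace] is defined. *)
Lemma kernel_restr V p q : kernel V p q = (vol V)^-1 *
  ((restr V p.1 == restr V p.2)%:R * (restr V q.1 == restr V q.2)%:R *
  ((restr (~: V) p.1 == restr (~: V) q.1)%:R *
   (restr (~: V) p.2 == restr (~: V) q.2)%:R)).
Proof.
rewrite -!prod_natr_eq /vol -prodfV -!big_split /= mulrA -!big_split /=.
rewrite [LHS](bigID (mem V)) /=; congr (_ * _).
  by apply: eq_bigr => i iV; rewrite /site_kernel iV mulrC.
apply: eq_big => i; first by rewrite inE.
by move=> /negbTE iV; rewrite /site_kernel iV.
Qed.

(* Exchanging the two middle configurations exchanges the roles of [V] and
   [~: V]; this yields the equality of the purities of complementary
   reductions of a pure state. *)
Lemma kernel_setC V (x y x' y' : conf) :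
  vol V * kernel V (x, y) (x', y') = vol (~: V) * kernel (~: V) (x, x') (y, y').
Proof.
rewrite !kernel_restr !mulVKf ?(vol_neq0 _ x) //= setCK; ring.
Qed.

End Kernel.

(** * Projected operators and their inner products *)

Section Twirl.
Variables (C : numClosedFieldType) (N : nat) (delta : 'I_N -> nat).
Variable rho : config delta * config delta -> C.
Implicit Types V : {set 'I_N}.
Local Notation pairs := (config delta * config delta)%type.

(** This is [P_V rho], with [rho] given by its matrix entries. *)
Definition twirl V (p : pairs) : C := \sum_q kernel C V p q * rho q.

(* For Hermitian [rho], this is Tr(rho_(~: V)^2) / vol V. *)
Definition purity V : C := inner rho (twirl V).

(** The kernel is real and symmetric, so [P_V] is self-adjoint and moves to the right argument,
    where [kernel_comp] merges it with [P_V']. *)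
Lemma inner_twirl V V' : inner (twirl V) (twirl V') = purity (V :|: V').
Proof.
rewrite /inner /purity /inner.
under eq_bigr do rewrite rmorph_sum mulr_suml.
rewrite exchange_big /=; apply: eq_bigr => q _.
transitivity (\sum_r (rho q)^* * (kernel C V q r * twirl V' r)).
  apply: eq_bigr => r _; rewrite rmorphM /= conj_kernel kernelC; ring.
rewrite -mulr_sumr; congr (_ * _).
under eq_bigr do rewrite mulr_sumr.
rewrite exchange_big /=; apply: eq_bigr => s _.
rewrite -kernel_comp mulr_suml; apply: eq_bigr => r _; ring.
Qed.

Lemma twirl_tr V : \sum_x twirl V (x, x) = \sum_x rho (x, x).
Proof.
rewrite exchange_big /=.
under eq_bigr do rewrite -mulr_suml kernel_tr.
rewrite sum_pair.
by apply: eq_bigr => x _; rewrite (sum_delta_sym (fun y => rho (x, y))).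
Qed.

(** As [V'] contains [V], the purity is the inner product of [P_V' rho] with [P_V rho]. The latter
    is c times the identity, so the result is c times the trace, which [P_V'] preserves. *)
Lemma purity_mixed V V' c :
  (forall p, twirl V p = (p.1 == p.2)%:R * c) -> V \subset V' ->
  \sum_x rho (x, x) = 1 -> purity V' = c.
Proof.
move=> mixed sVV' tr1.
have /setUidPl <- := sVV'; rewrite -inner_twirl /inner.
rewrite sum_pair.
transitivity ((\sum_x twirl V' (x, x))^* * c); last first.
  by rewrite twirl_tr tr1 rmorph1 mul1r.
rewrite rmorph_sum mulr_suml; apply: eq_bigr => x _.
rewrite -(sum_delta_sym (fun y => (twirl V' (x, y))^* * c)).
by apply: eq_bigr => y _; rewrite mixed mulrCA.
Qed.

Lemma purity_bessel (T : {set 'I_N}) :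
  (forall i j, i \in T -> j \in T -> i != j ->
     purity (i |: (j |: ~: T)) = purity setT) ->
  \sum_(i in T) (purity (i |: ~: T) - purity setT) <=
  purity (~: T) - purity setT.
Proof.
move=> Hij.
pose X V p := twirl V p - twirl setT p.
(* Every term of the expansion that involves [setT] equals [purity setT], and the signs add up to
   -1. *)
have XX V V' : inner (X V) (X V') = purity (V :|: V') - purity setT.
  have -> : inner (X V) (X V') = inner (twirl V) (twirl V')
    - inner (twirl V) (twirl setT) - inner (twirl setT) (twirl V')
    + inner (twirl setT) (twirl setT).
    rewrite /inner -!sumrB -big_split; apply: eq_bigr => p _ /=.
    rewrite /X rmorphB; ring.
  by rewrite !inner_twirl setUT !setTU subrK.
have := @bessel _ _ _ T (X (~: T)) (fun i => X (i |: ~: T)).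
rewrite XX setUid; under eq_bigr do rewrite XX setUid.
apply=> [i iT|i j iT jT ij].
  by rewrite !XX setUC -setUA !setUid.
by rewrite XX setUACA setUid -setUA Hij // subrr.
Qed.

End Twirl.

(** * Purities of an AME state *)

Section AMEPurity.
Variables (R : realType) (N : nat) (delta : 'I_N -> nat).
Variable psi : 'cV[R[i]]_#|config delta|.
Hypothesis amepsi : AME psi.
Implicit Types V : {set 'I_N}.
Local Notation C := (R[i]).

Definition pure_density (p : config delta * config delta) : C :=
  psi (enum_rank p.1) 0 * (psi (enum_rank p.2) 0)^*.

Lemma density_pure x y :
  density psi (enum_rank x) (enum_rank y) = pure_density (x, y).
Proof. by rewrite mxE big_ord1 !mxE. Qed.

Lemma tr_pure_density : \sum_x pure_density (x, x) = 1.
Proof.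
have [<- _] := amepsi.
rewrite [RHS](reindex enum_rank); last exact/onW_bij/enum_rank_bij.
by apply: eq_bigr => x _; rewrite normCK.
Qed.

(** Without configurations the trace would be 0, not 1. The witness makes every dimension, hence
    every [vol], nonzero. *)
Lemma config_inhabited : {x : config delta | true}.
Proof.
case: (pickP (fun x : config delta => true)) => [x _|e]; first by exists x.
have := tr_pure_density; rewrite big_pred0 // => /esym/eqP.
by rewrite oner_eq0.
Qed.

(** [P_V rho] is the reduction to [~: V] tensored with the maximally mixed state on [V]; the AME
    property makes the first factor maximally mixed as well. *)
Lemma twirl_AME V p : #|~: V| = N./2 ->
  twirl pure_density V p = (p.1 == p.2)%:R * (vol C delta setT)^-1.
Proof.
case: amepsi => _ ame hV; have := ame _ hV.
move=> /matrixP/(_ (enum_rank (restr (~: V) p.1)) (enum_rank (restr (~: V) p.2))).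
rewrite !mxE !enum_rankK setCK (inj_eq enum_rank_inj) => E.
have -> : twirl pure_density V p = (vol C delta V)^-1 *
    (restr V p.1 == restr V p.2)%:R *
    ((vol C delta (~: V))^-1 * (restr (~: V) p.1 == restr (~: V) p.2)%:R).
  rewrite -[X in _ = _ * X]E /twirl sum_pair [in RHS]big_mkcond mulr_sumr.
  apply: eq_bigr => x _; rewrite [in RHS]big_mkcond /=.
  case: ifP => xp; last first.
    rewrite mulr0 big1 // => y _.
    by rewrite kernel_restr /= [_ p.1 == restr (~: V) x]eq_sym xp !(mul0r, mulr0).
  rewrite mulr_sumr; apply: eq_bigr => y _.
  rewrite kernel_restr /= density_pure [_ p.1 == restr (~: V) x]eq_sym
    [_ p.2 == restr (~: V) y]eq_sym xp.
  case: (restr _ y == _); case: (restr _ x == restr _ y);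
    rewrite /= ?(mulr0, mul0r, mulr1, mul1r) //.
rewrite mulrACA -invfM mulrC vol_setC.
by rewrite -!prod_natr_eq prod_setC prod_all_natr_eq.
Qed.

(** For a pure state the summand contains four amplitudes whose product is symmetric in [y] and
    [x'], so exchanging these two variables affects the kernel alone, as in [kernel_setC]. *)
Lemma purity_setC V :
  vol C delta V * purity pure_density V =
  vol C delta (~: V) * purity pure_density (~: V).
Proof.
pose F U (x y x' y' : config delta) := (pure_density (x, y))^* *
  (vol C delta U * kernel C U (x, y) (x', y') * pure_density (x', y')).
have E U : vol C delta U * purity pure_density U =
    \sum_x \sum_y \sum_x' \sum_y' F U x y x' y'.
  rewrite /purity /inner mulr_sumr.
  rewrite sum_pair; apply: eq_bigr => x _; apply: eq_bigr => y _.
  rewrite /twirl mulrCA mulr_sumr mulr_sumr sum_pair.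
  by apply: eq_bigr => x' _; apply: eq_bigr => y' _; rewrite /F !mulrA.
rewrite !E; apply: eq_bigr => x _; rewrite exchange_big.
apply: eq_bigr => y _; apply: eq_bigr => x' _; apply: eq_bigr => y' _.
rewrite /F kernel_setC /pure_density /= !rmorphM /= !conjCK; ring.
Qed.

Lemma purity_gt_half V : (N < #|V|.*2)%N ->
  purity pure_density V = (vol C delta setT)^-1.
Proof.
move=> ltNV; have leV : (N - N./2 <= #|V|)%N by lia.
(* The size of [V'] is chosen so that its complement has exactly [N./2] elements, the size in the
   AME condition. *)
have [V' sV'V cV'] := ex_subset_card leV.
apply: purity_mixed sV'V tr_pure_density => p.
by apply: twirl_AME; rewrite cardsCs setCK card_ord cV'; lia.
Qed.

(** The complement holds more than half of the factors, so its purity is known and [purity_setC]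
    carries it over. *)
Lemma purity_lt_half V : (#|V|.*2 < N)%N ->
  purity pure_density V = vol C delta V ^- 2.
Proof.
move=> ltVN; have [x0 _] := config_inhabited.
have v0 U : vol C delta U != 0 := vol_neq0 C U x0.
have := purity_setC V; rewrite (@purity_gt_half (~: V)); last first.
  by rewrite cardsCs setCK card_ord; lia.
rewrite -(vol_setC C delta V).
move=> E; apply: (mulfI (v0 V)); rewrite E; field.
by rewrite !v0.
Qed.

(** The complement of [T] has (N - 3)/2 elements: adding one stays below half of the factors, adding
    two goes above. This fixes all purities in [purity_bessel] and gives the orthogonality; scaling
    by [vol (~: T) ^+ 2] turns the purity of [~: T] into 1. *)
Lemma AME_ineq (T : {set 'I_N}) : (N.+3 = #|T|.*2)%N ->
  \sum_(i in T) ((delta i)%:R ^- 2 - vol C delta (~: T) / vol C delta T) <=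
  1 - vol C delta (~: T) / vol C delta T.
Proof.
move=> cT; have [x0 _] := config_inhabited.
have v0 U : vol C delta U != 0 := vol_neq0 C U x0.
have cW : #|~: T| = (N - #|T|)%N by rewrite cardsCs setCK card_ord.
have cTN : (#|T| <= N)%N by rewrite -[leqRHS]card_ord max_card.
have cW1 i : i \in T -> #|i |: ~: T| = (N - #|T|).+1.
  by move=> iT; rewrite cardsU1 inE iT cW.
have cW2 i j : i \in T -> j \in T -> i != j ->
    #|i |: (j |: ~: T)| = (N - #|T|).+2.
  by move=> iT jT ij; rewrite cardsU1 cW1 // !inE iT (negbTE ij).
have /purity_bessel: forall i j, i \in T -> j \in T -> i != j ->
    purity pure_density (i |: (j |: ~: T)) = purity pure_density setT.
  move=> i j iT jT ij.
  rewrite !purity_gt_half ?cW2 ?cardsT ?card_ord //; lia.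
rewrite (@purity_gt_half setT) ?cardsT ?card_ord; last lia.
rewrite purity_lt_half; last lia.
rewrite -(ler_pM2l (_ : 0 < vol C delta (~: T) ^+ 2)); last first.
  by rewrite exprn_gt0 // lt_def v0 prodr_ge0.
rewrite mulr_sumr mulrBr mulfV ?expf_neq0 // -(vol_setC C delta T).
apply: eq_ind; congr (_ <= 1 - _).
  apply: eq_bigr => i iT.
  rewrite purity_lt_half; last by rewrite cW1 //; lia.
  have -> : vol C delta (i |: ~: T) = (delta i)%:R * vol C delta (~: T).
    by rewrite /vol big_setU1 // inE iT.
  field.
  by rewrite !v0 (ord_natr_neq0 _ (x0 i)).
by field; rewrite !v0.
Qed.

End AMEPurity.

(** * Dimension inequalities for one factor d1 and 2n factors d2 *)

Section OnePlusEven.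
Variables (R : realType) (n d1 d2 : nat).
Hypotheses (d1_gt0 : (0 < d1)%N) (d2_gt0 : (0 < d2)%N).
Variable psi : 'cV[R[i]]_#|config (one_plus_even_dims n d1 d2)|.
Hypothesis amepsi : AME psi.
Local Notation C := (R[i]).
Local Notation dims := (one_plus_even_dims n d1 d2).

Fact one_plus_even_gt0 : (0 < 2 * n + 1)%N. Proof. by rewrite addn1. Qed.
Let o := Ordinal one_plus_even_gt0.

Lemma dims_o : dims o = d1. Proof. by []. Qed.

Lemma dims_not_o i : i != o -> dims i = d2.
Proof.
move=> io; rewrite /one_plus_even_dims; case: eqP => // i0.
by case/eqP: io; exact/val_inj.
Qed.

Lemma vol_without (A : {set 'I_(2 * n + 1)}) : o \notin A ->
  vol C dims A = d2%:R ^+ #|A|.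
Proof.
move=> oA; rewrite /vol -prodr_const; apply: eq_bigr => i iA.
by rewrite dims_not_o //; apply: contraNneq oA => <-.
Qed.

Lemma vol_with (A : {set 'I_(2 * n + 1)}) : o \in A ->
  vol C dims A = d1%:R * d2%:R ^+ #|A|.-1.
Proof.
move=> oA; rewrite /vol (big_setD1 o oA) /= -/(vol _ _ _) vol_without ?setD11 //.
by rewrite (cardsD1 o A) oA.
Qed.

Lemma card_without : #|[set~ o]| = (2 * n)%N.
Proof. by rewrite cardsC1 card_ord addn1. Qed.

Let d1C : d1%:R != 0 :> C. Proof. by rewrite pnatr_eq0 -lt0n. Qed.
Let d2C : d2%:R != 0 :> C. Proof. by rewrite pnatr_eq0 -lt0n. Qed.

(** This is (n + 2)(d2^2 - d1) <= d2^4 - d1, rearranged to avoid truncated subtraction. From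
    [2 <= n], the 2n factors of dimension d2 suffice to choose n + 2 of them. *)
Lemma AME_ineq_without : (2 <= n)%N ->
  (n.+2 * d2 ^ 2 + d1 <= d2 ^ 4 + n.+2 * d1)%N.
Proof.
move=> n2; have [|T sT cT] := @ex_subset_card _ [set~ o] n.+2.
  by rewrite card_without; lia.
have oT : o \notin T by apply/negP => /(subsetP sT); rewrite !inE eqxx.
have /(AME_ineq amepsi) : (2 * n + 1).+3 = #|T|.*2 by lia.
have -> : vol C dims (~: T) / vol C dims T = d1%:R / d2%:R ^+ 4.
  rewrite (@vol_without T) // vol_with ?inE // cT [#|~: T|]cardsCs setCK card_ord cT.
  have -> : (2 * n + 1 - n.+2).-1 = (n - 2)%N by lia.
  have -> : n.+2 = ((n - 2) + 4)%N by lia.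
  rewrite exprD; field.
  by rewrite d2C expf_neq0.
rewrite (eq_bigr (fun=> d2%:R ^- 2 - d1%:R / d2%:R ^+ 4)); last first.
  by move=> i iT; rewrite dims_not_o //; apply: contraNneq oT => <-.
rewrite sumr_const cT.
rewrite -(ler_pM2l (_ : 0 < d2%:R ^+ 4)); last by rewrite exprn_gt0 // ltr0n.
rewrite -[_ *+ n.+2]mulr_natr -subr_ge0 => ge0.
rewrite -(ler_nat C) !(natrD, natrM, natrX) -subr_ge0.
by apply: le_trans ge0 _; rewrite le_eqVlt; apply/orP; left; apply/eqP; field.
Qed.

Lemma AME_ineq_with : (1 <= n)%N -> (1 < d1)%N ->
  (n.+1 * d1 <= d2 ^ 2 * (d1 + 1))%N.
Proof.
move=> n1 d1_gt1; have [|B sB cB] := @ex_subset_card _ [set~ o] n.+1.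
  by rewrite card_without; lia.
have oB : o \notin B by apply/negP => /(subsetP sB); rewrite !inE eqxx.
have cT : #|o |: B| = n.+2 by rewrite cardsU1 oB cB.
have /(AME_ineq amepsi) : (2 * n + 1).+3 = #|o |: B|.*2 by lia.
have -> : vol C dims (~: (o |: B)) / vol C dims (o |: B) =
    (d1%:R * d2%:R ^+ 2)^-1.
  rewrite vol_without ?inE ?eqxx // vol_with ?inE ?eqxx // cT.
  rewrite cardsCs setCK card_ord cT.
  have -> : (2 * n + 1 - n.+2)%N = (n - 1)%N by lia.
  have -> : n.+2.-1 = ((n - 1) + 2)%N by lia.
  rewrite exprD; field.
  by rewrite d1C d2C expf_neq0.
rewrite big_setU1 //= dims_o.
rewrite (eq_bigr (fun=> d2%:R ^- 2 - (d1%:R * d2%:R ^+ 2)^-1)); last first.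
  by move=> i iT; rewrite dims_not_o //; apply: contraNneq oB => <-.
rewrite sumr_const cB.
rewrite -(ler_pM2l (_ : 0 < d1%:R ^+ 2 * d2%:R ^+ 2)); last first.
  by rewrite mulr_gt0 // exprn_gt0 // ltr0n.
rewrite -[_ *+ n.+1]mulr_natr -subr_ge0 => ge0.
(* After clearing denominators both sides carry the factor d1 - 1, which is positive because
   [1 < d1]. *)
suff : (n.+1 * d1 * (d1 - 1) <= d2 ^ 2 * (d1 + 1) * (d1 - 1))%N.
  by rewrite leq_pmul2r // subn_gt0.
rewrite -(ler_nat C) !(natrD, natrM, natrX) natrB 1?ltnW // -subr_ge0.
apply: le_trans ge0 _; rewrite le_eqVlt; apply/orP; left; apply/eqP.
by field; rewrite d1C d2C.
Qed.

End OnePlusEven.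

Theorem corollary11 (R : realType) (n d1 d2 : nat)
    (hn : (1 <= n)%N) (hd1 : (2 <= d1)%N) (hd2 : (2 <= d2)%N)
    (hd12 : (d1 <= d2 ^ 2)%N)
    (hcase :
      ((d1 < d2)%N /\
        n%:R > (d2%:R ^+ 4 - d1%:R) / (d2%:R ^+ 2 - d1%:R) - 2 :> R) \/
      (((d2 <= d1)%N /\ (d1 <= d2 ^ 2)%N) /\
        n%:R > d2%:R ^+ 2 * (d1%:R + 1) / d1%:R - 1 :> R)) :
  ~ exists psi : 'cV[R[i]]_#|config (one_plus_even_dims n d1 d2)|, AME psi.
Proof.
case=> psi amepsi.
have d1_gt0 : (0 < d1)%N by lia.
have d2_gt0 : (0 < d2)%N by lia.
case: hcase => [[lt12]|[_]].
- have d12 : (d1 < d2 ^ 2)%N by nia.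
  rewrite ltrBlDr ltr_pdivrMr; last by rewrite subr_gt0 -natrX ltr_nat.
  move=> h; have : (d2 ^ 4 + n.+2 * d1 < n.+2 * d2 ^ 2 + d1)%N.
    by rewrite -(ltr_nat R) -[n.+2]addn2 !(natrD, natrM, natrX); lra.
  have [n2|n1] := leqP 2 n.
    by rewrite ltnNge (AME_ineq_without d1_gt0 d2_gt0 amepsi).
  (* For n = 1 no suitable [T] exists, but the assumed bound reads d2^4 + 2 d1 < 3 d2^2, which is
     absurd as d2^2 >= 4. *)
  have -> : n = 1%N by lia.
  rewrite (expnM _ 2 2); nia.
- rewrite ltrBlDr ltr_pdivrMr ?ltr0n // => h.
  have : (d2 ^ 2 * (d1 + 1) < n.+1 * d1)%N.
    by rewrite -(ltr_nat R) -[n.+1]addn1 !(natrD, natrM, natrX).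
  by rewrite ltnNge (AME_ineq_with d1_gt0 d2_gt0 amepsi).
Qed.
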